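(* Let $R$ be a ring, and let $a,b,c\in R$. If $aba=aca$, then $ac$ has Hirano inverse if and only if $ba$ has Hirano inverse. In this case, $(ba)^{H}=b\left((ac)^{H}\right)^2a$.
   Context: All rings are associative with identity. $N(R)$ denotes the set of all nilpotent elements of $R$. An element $x\in R$ has Hirano inverse if there exists $y\in R$ such that $x^2-xy\in N(R)$, $xy=yx$ and $y=yxy$; such a $y$ is unique if it exists and is denoted by $x^H$. *)

(* Defs.v *)
From HB Require Import structures.
From mathcomp Require Import all_boot all_algebra.

Set Implicit Arguments.
Unset Strict Implicit.
Unset Printing Implicit Defensive.

Import GRing.Theory.
Local Open Scope ring_scope.

(* Rings are taken in [pzRingType]: unital, possibly noncommutative, and the
   zero ring is allowed. *)

(* The exponent 0 is harmless: x ^+ 0 = 0 forces 1 = 0. *)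
Definition nilpotent_elt (R : pzRingType) (x : R) : Prop :=
  exists n : nat, x ^+ n = 0.

Definition is_hirano_inverse (R : pzRingType) (x y : R) : Prop :=
  [/\ nilpotent_elt (x ^+ 2 - x * y), x * y = y * x & y = y * x * y].

Definition has_hirano_inverse (R : pzRingType) (x : R) : Prop :=
  exists y : R, is_hirano_inverse x y.

(* The partial function x |-> x^H is represented by its graph
   [is_hirano_inverse], which the next two lemmas show to be functional. *)

Lemma hirano_exp (R : pzRingType) (x y : R) :
  is_hirano_inverse x y -> exists n : nat, forall k : nat, (n <= k)%N -> x ^+ k = x ^+ k.+1 * y.
Proof.
move=> [[n xn0] cxy yxy].
have idem : x * y * (x * y) = x * y by rewrite -mulrA [y * _]mulrA -yxy.
have cx : GRing.comm x (x * y) by rewrite /GRing.comm {1}cxy mulrA.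
have cw : GRing.comm (x ^+ 2) (x * y) by apply/commr_sym/commrX/commr_sym.
have cp : x ^+ 2 * (1 - x * y) = (1 - x * y) * x ^+ 2.
  by rewrite mulrBr mulrBl mulr1 mul1r cw.
have wp : (x ^+ 2 - x * y) * (1 - x * y) = x ^+ 2 * (1 - x * y).
  by rewrite mulrBl [x * y * (1 - _)]mulrBr mulr1 idem subrr subr0.
have key m : (x ^+ 2 - x * y) ^+ m * (1 - x * y) = x ^+ (2 * m)%N * (1 - x * y).
  elim: m => [|m IHm]; first by rewrite muln0 !expr0.
  by rewrite exprSr -mulrA wp cp mulrA IHm -mulrA -cp mulrA -exprD mulnS addnC.
exists (2 * n)%N => k le_nk; rewrite exprSr -mulrA.
have: x ^+ (2 * n) * (1 - x * y) = 0 by rewrite -key xn0 mul0r.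
rewrite mulrBr mulr1 => /subr0_eq e.
by rewrite -(subnK le_nk) exprD -mulrA -e.
Qed.

Lemma hirano_inverse_unique (R : pzRingType) (x y z : R) :
  is_hirano_inverse x y -> is_hirano_inverse x z -> y = z.
Proof.
move=> hy hz; have [n hn] := hirano_exp hy; have [m hm] := hirano_exp hz.
case: hy => _ cxy yxy; case: hz => _ cxz zxz.
pose k := (n + m)%N.
have ek : x ^+ k = x ^+ k.+1 * y by apply: hn; rewrite leq_addr.
have fk : x ^+ k = x ^+ k.+1 * z by apply: hm; rewrite leq_addl.
have yk : y = y ^+ k.+1 * x ^+ k.
  elim: k {ek fk} => [|j IHj]; first by rewrite expr0 expr1 mulr1.
  have -> : y ^+ j.+2 * x ^+ j.+1 = y * (y ^+ j.+1 * x ^+ j) * x.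
    by rewrite (exprS y) (exprSr x) !mulrA.
  by rewrite -IHj -mulrA -cxy mulrA.
have zk : z = x ^+ k * z ^+ k.+1.
  elim: k {ek fk yk} => [|j IHj]; first by rewrite expr0 expr1 mul1r.
  have -> : x ^+ j.+1 * z ^+ j.+2 = x * (x ^+ j * z ^+ j.+1) * z.
    by rewrite (exprS x) (exprSr z) !mulrA.
  by rewrite -IHj cxz.
have -> : y = y * x * z.
  by rewrite {1}yk fk (exprSr x) !mulrA -yk.
have cyx : GRing.comm y (x ^+ k.+1) by apply: commrX.
by rewrite [RHS]zk ek -cyx (exprS x) -!mulrA -zk mulrA.
Qed.

(* Main.v *)
Require Import Defs.
From mathcomp Require Import all_boot all_algebra.

(** The identity [a * b * a = a * c * a] says that [a] intertwines [a * c] with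
    [b * a], namely [(a * c) * a = a * (b * a)].  If [y] is the Hirano inverse of
    [x = a * c], then [y = a * (c * y ^+ 2)] is a left multiple of [a], so the
    identity also lets [a * b] act on [y] as [x] does.  With these two
    exchange rules, [z = b * y ^+ 2 * a] satisfies [b * a * z = b * y * a =
    z * (b * a)] and [z = z * (b * a) * z], while
    [(b * a) ^+ 2 - b * a * z = b * (x - y) * a].  The powers of the latter
    element contain those of [x * (x - y) = x ^+ 2 - x * y], hence vanish
    eventually ([hirano_inverse_cline]).

    The converse is the same statement in the opposite ring: reversing products
    while exchanging [b] and [c] preserves the hypothesis and swaps [a * c] with
    [b * a], and the notion of Hirano inverse is left-right symmetric
    ([hirano_inverse_opposite]).  The formula follows from uniqueness of the
    Hirano inverse. *)

Import GRing.Theory.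
Local Open Scope ring_scope.

(** In [(b * d * a) ^+ n.+1] every inner factor [a * b * d * a] collapses to
    [x * d * a], leaving a power of [x * d] between [b * d] and [a]. *)
Lemma nilpotent_sandwich (R : pzRingType) (a b d x : R) :
  a * b * d * a = x * d * a -> nilpotent_elt (x * d) -> nilpotent_elt (b * d * a).
Proof.
move=> abda [n xdn0]; exists n.+1.
have -> : (b * d * a) ^+ n.+1 = b * d * (x * d) ^+ n * a.
  elim: {xdn0} n => [|n IHn]; first by rewrite expr1 expr0 mulr1.
  have inner : a * (b * d * a) = x * d * a by rewrite !mulrA.
  by rewrite exprSr IHn -(mulrA _ a) inner [in RHS]exprSr !mulrA.
by rewrite xdn0 mulr0 mul0r.
Qed.

(** A Cline-type formula: one direction of the equivalence, together with the
    explicit inverse. *)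
Lemma hirano_inverse_cline (R : pzRingType) (a b c y : R) :
  a * b * a = a * c * a -> is_hirano_inverse (a * c) y ->
  is_hirano_inverse (b * a) (b * y ^+ 2 * a).
Proof.
move=> haba; set x := a * c => -[nil_xy cxy yxy].
have xyy : x * y * y = y by rewrite cxy -yxy.
have aby : a * b * y = x * y.
  (* Writing the left-hand y as a * (c * y * y) exposes a * b * a. *)
  by rewrite -{1}xyy /x !mulrA haba -!mulrA !(mulrA a c) -/x (mulrA x y y) xyy.
have wz : b * a * (b * y ^+ 2 * a) = b * y * a.
  have -> : b * a * (b * y ^+ 2 * a) = b * (a * b * y * y) * a.
    by rewrite expr2 !mulrA.
  by rewrite aby xyy.
have zw : b * y ^+ 2 * a * (b * a) = b * y * a.
  have -> : b * y ^+ 2 * a * (b * a) = b * (y * y) * (a * b * a).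
    by rewrite expr2 !mulrA.
  rewrite haba -/x.
  have -> : b * (y * y) * (x * a) = b * (y * (y * x)) * a by rewrite !mulrA.
  by rewrite -cxy (mulrA y x) -yxy.
split; last 2 first.
- by rewrite wz zw.
- rewrite zw.
  have -> : b * y * a * (b * y ^+ 2 * a) = b * y * (a * b * y * y) * a.
    by rewrite expr2 !mulrA.
  by rewrite aby xyy expr2 mulrA.
have -> : (b * a) ^+ 2 - b * a * (b * y ^+ 2 * a) = b * (x - y) * a.
  have -> : (b * a) ^+ 2 = b * (a * b * a) by rewrite expr2 !mulrA.
  by rewrite wz haba -/x mulrBr mulrBl !mulrA.
apply: (@nilpotent_sandwich _ _ _ _ x); last by rewrite mulrBr -expr2.
by rewrite !mulrBr aby /x !mulrA haba.
Qed.

Lemma hirano_inverse_opposite (R : pzRingType) (x y : R) :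
  is_hirano_inverse x y -> is_hirano_inverse (x : R^c) (y : R^c).
Proof.
case=> [[n nil_n] cxy yxy]; split.
- exists n; rewrite -[RHS]nil_n cxy; exact: revrX.
- exact: esym.
- by rewrite {1}yxy -mulrA.
Qed.

Theorem theorem4p1 (R : pzRingType) (a b c : R)
    (haba : a * b * a = a * c * a) :
  (has_hirano_inverse (a * c) <-> has_hirano_inverse (b * a)) /\
  (forall y z : R,
     is_hirano_inverse (a * c) y -> is_hirano_inverse (b * a) z ->
     z = b * y ^+ 2 * a).
Proof.
split=> [|y z hy hz]; last first.
  exact: hirano_inverse_unique hz (hirano_inverse_cline _ _ _ _ _ haba hy).
split=> [[y hy]|[z hz]].
  by exists (b * y ^+ 2 * a); apply: hirano_inverse_cline hy.
(* In the opposite ring b * a is the product of a and b, and a * c that of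
   c and a. *)
have haca : (a : R^c) * (c : R^c) * (a : R^c) = (a : R^c) * (b : R^c) * (a : R^c).
  by change (a * (c * a) = a * (b * a)); rewrite !mulrA haba.
have := hirano_inverse_cline _ _ _ _ _ haca (hirano_inverse_opposite _ _ _ hz).
by move/hirano_inverse_opposite => hy; eexists; exact: hy.
Qed.
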